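(* Every member of $\mathcal{B}$ is isomorphic to some restriction of $I_{wf}$ and also to some restriction of $I_d$; that is, for every $I\in\mathcal{B}$ there are $A,A'\subseteq\mathbb{N}^{<\omega}$ such that $I\cong I_{wf}\upharpoonright A$ and $I\cong I_d\upharpoonright A'$.
   Context: An ideal over a countable set $X$ is a family of subsets of $X$ that contains every finite subset of $X$ and is closed under taking subsets and finite unions ($\mathcal{P}(X)$ is allowed). Two ideals $I$ on $X$ and $J$ on $Y$ are isomorphic ($I\cong J$) if there is a bijection $f:X\to Y$ such that $A\in I$ iff $f[A]\in J$. $I\upharpoonright K$ is the ideal on $K$ of all subsets of $K$ belonging to $I$. The orthogonal of $I$ is $I^\perp=\{B\subseteq X: A\cap B\text{ is finite for all }A\in I\}$. Direct sum: given finitely or countably many ideals $I_n$ on countably infinite sets $X_n$, take a partition $\{K_n\}$ of $\mathbb{N}$ and an isomorphic copy $I_n'$ of $I_n$ on $K_n$; then $A\in\bigoplus_n I_n$ iff $A\cap K_n\in I_n'$ for all $n$ (well defined up to isomorphism). $\mathcal{B}$ is the smallest collection of ideals on $\mathbb{N}$ (regarded as closed under isomorphism) containing the ideal of finite sets and closed under countable (including finite) direct sums and orthogonal. $\mathbb{N}^{<\omega}$ is the set of finite sequences of natural numbers ordered by extension $\preceq$; a tree is a $\preceq$-downward closed subset, and it is well founded if it has no infinite branch. $I_{wf}$ is the ideal on $\mathbb{N}^{<\omega}$ of sets contained in a well founded tree. $I_d=I_{wf}^\perp$ is the ideal generated by the finitely branching trees; equivalently, $A\in I_d$ iff there is $\alpha\in\mathbb{N}^\omega$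 such that $s(i)\le\alpha(i)$ for all $s\in A$ and all $i<|s|$. *)

(* Defs.v *)
From mathcomp Require Import all_boot.
From mathcomp Require Import mathcomp_extra boolp classical_sets functions cardinality.

Set Implicit Arguments.
Unset Strict Implicit.
Unset Printing Implicit Defensive.

Local Open Scope classical_set_scope.

#[local] Obligation Tactic := idtac.

(* A countable set is a subset X of a countType T; a family of subsets of X is
   a predicate on set T all of whose members are included in X. *)
Record ideal (T : countType) (X : set T) := Ideal {
  mem_ideal :> set T -> Prop;
  ideal_subset : forall A, mem_ideal A -> A `<=` X;
  ideal_finite : forall A, A `<=` X -> finite_set A -> mem_ideal A;
  ideal_sub : forall A B, A `<=` B -> mem_ideal B -> mem_ideal A;
  ideal_setU : forall A B, mem_ideal A -> mem_ideal B -> mem_ideal (A `|` B)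
}.

Definition ideal_iso (T U : countType) (X : set T) (Y : set U)
    (I : ideal X) (J : ideal Y) : Prop :=
  exists f : T -> U,
    set_bij X Y f /\ forall A : set T, A `<=` X -> (I A <-> J (f @` A)).

Program Definition restr (T : countType) (X : set T) (I : ideal X)
    (K : set T) (KX : K `<=` X) : ideal K :=
  @Ideal T K (fun B => B `<=` K /\ I B) _ _ _ _.
Next Obligation. by move=> T X I K KX A []. Qed.
Next Obligation.
move=> T X I K KX A AK Afin; split=> //.
by apply: ideal_finite => //; apply: subset_trans KX.
Qed.
Next Obligation.
move=> T X I K KX A B AB [BK IB].
by split; [apply: subset_trans BK|apply: ideal_sub IB].
Qed.
Next Obligation.
move=> T X I K KX A B [AK IA] [BK IB].
by split; [rewrite subUset|apply: ideal_setU].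
Qed.

Program Definition fin_ideal (T : countType) (X : set T) : ideal X :=
  @Ideal T X (fun B => B `<=` X /\ finite_set B) _ _ _ _.
Next Obligation. by move=> T X A []. Qed.
Next Obligation. by []. Qed.
Next Obligation.
move=> T X A B AB [BX Bfin].
by split; [apply: subset_trans BX|apply: sub_finite_set Bfin].
Qed.
Next Obligation.
move=> T X A B [AX Afin] [BX Bfin].
by split; [rewrite subUset|rewrite finite_setU].
Qed.

Program Definition orth (T : countType) (X : set T) (I : ideal X) : ideal X :=
  @Ideal T X
    (fun B => B `<=` X /\ forall A, I A -> finite_set (A `&` B)) _ _ _ _.
Next Obligation. by move=> T X I A []. Qed.
Next Obligation.
by move=> T X I B BX Bfin; split=> // A _; apply: finite_setIr.
Qed.
Next Obligation.
move=> T X I B C BC [CX CI]; split=> [|A IA]; first exact: subset_trans CX.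
by apply: sub_finite_set (CI _ IA); apply: setIS.
Qed.
Next Obligation.
move=> T X I B C [BX BI] [CX CI]; split=> [|A IA]; first by rewrite subUset.
by rewrite setIUr finite_setU; split; [apply: BI|apply: CI].
Qed.

(* The direct sum of ideals J n already transported to the pieces K n (n in D)
   of a partition of nat. *)
Program Definition dsum (D : set nat) (K : nat -> set nat)
    (J : forall n, ideal (K n)) : ideal [set: nat] :=
  @Ideal nat [set: nat] (fun A => forall n, D n -> J n (A `&` K n)) _ _ _ _.
Next Obligation. by []. Qed.
Next Obligation.
by move=> D K J A _ Afin n _; apply: ideal_finite; [|apply: finite_setIl].
Qed.
Next Obligation.
by move=> D K J A B AB BJ n Dn; apply: ideal_sub (BJ n Dn); apply: setSI.
Qed.
Next Obligation.
move=> D K J A B AJ BJ n Dn; rewrite setIUl.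
by apply: ideal_setU; [apply: AJ|apply: BJ].
Qed.

(* The index set D of a direct sum is an arbitrary, finite or infinite, set of
   natural numbers.  The pieces K n are infinite, being in bijection with nat;
   the values of I and J outside D are irrelevant. *)
Inductive calB : ideal [set: nat] -> Prop :=
| calB_fin : calB (fin_ideal [set: nat])
| calB_orth (I : ideal [set: nat]) : calB I -> calB (orth I)
| calB_dsum (D : set nat) (K : nat -> set nat)
    (I : nat -> ideal [set: nat]) (J : forall n, ideal (K n)) :
    partition D K [set: nat] ->
    (forall n, D n -> calB (I n)) ->
    (forall n, D n -> ideal_iso (I n) (J n)) ->
    calB (dsum D J)
| calB_iso (I J : ideal [set: nat]) : calB I -> ideal_iso I J -> calB J.

Definition tree (T : set (seq nat)) : Prop :=
  forall s t, prefix s t -> T t -> T s.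

(* mkseq alpha n = [:: alpha 0; ...; alpha n.-1] *)
Definition well_founded_tree (T : set (seq nat)) : Prop :=
  tree T /\ ~ exists alpha : nat -> nat, forall n, T (mkseq alpha n).

Lemma prefix_mkseq (alpha : nat -> nat) m n :
  m <= n -> prefix (mkseq alpha m) (mkseq alpha n).
Proof.
move=> mn; rewrite prefixE size_mkseq /mkseq -map_take take_iota.
by rewrite (minn_idPl mn).
Qed.

Lemma well_founded_treeU (T1 T2 : set (seq nat)) :
  well_founded_tree T1 -> well_founded_tree T2 -> well_founded_tree (T1 `|` T2).
Proof.
move=> [tT1 wT1] [tT2 wT2]; split=> [s t st [?|?]|[a aT]].
- by left; apply: tT1 st _.
- by right; apply: tT2 st _.
apply: wT1; exists a => n; apply: contrapT => nT1; apply: wT2; exists a => m.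
have [T1nm|] := aT (maxn n m); last first.
  by apply: tT2; apply: prefix_mkseq; apply: leq_maxr.
by case: nT1; apply: tT1 T1nm; apply: prefix_mkseq; apply: leq_maxl.
Qed.

Lemma well_founded_tree_size N : well_founded_tree [set s | size s <= N].
Proof.
split=> [s t /size_prefix st /= tN|[a aN]]; first exact: leq_trans tN.
have : size (mkseq a N.+1) <= N := aN N.+1.
by rewrite size_mkseq ltnn.
Qed.

Program Definition Iwf : ideal [set: seq nat] :=
  @Ideal (seq nat) [set: seq nat]
    (fun A => exists2 T, well_founded_tree T & A `<=` T) _ _ _ _.
Next Obligation. by []. Qed.
Next Obligation.
move=> A _ /finite_seqP[r ->].
exists [set s | size s <= \max_(t <- r) size t].
  exact: well_founded_tree_size.
by move=> s /= sr; apply: leq_bigmax_seq.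
Qed.
Next Obligation.
by move=> A B AB [T wT BT]; exists T => //; apply: subset_trans BT.
Qed.
Next Obligation.
move=> A B [S wS AS] [T wT BT]; exists (S `|` T).
  exact: well_founded_treeU.
exact: setUSS.
Qed.

Definition Id : ideal [set: seq nat] := orth Iwf.

(* Main.v *)
Require Import Defs.
From mathcomp Require Import all_boot.
From mathcomp Require Import mathcomp_extra boolp classical_sets functions cardinality.
Local Open Scope classical_set_scope.

Set Implicit Arguments.
Unset Strict Implicit.
Unset Printing Implicit Defensive.

(** A set lies in [Iwf] iff no branch has all its initial segments extended by
    members of the set; picking one extension of each segment gives an infinite
    member of [Id], whence the orthogonal of [Id] is again [Iwf].  As orthogonals
    commute with restrictions, passing from [I] to its orthogonal exchanges the
    two halves of the claim.  A direct sum is handled by placing the summands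
    above pairwise incompatible nodes: [:: n] for [Iwf], and [0^n 1] for [Id],
    since a well-founded tree contains only finitely many of the nodes [0^n]
    and so meets only finitely many of the latter summands. *)

(** Up to isomorphism this is a restriction of [L] to the image of [X]; leaving that image unnamed
    lets embeddings pass through orthogonals and sums. *)
Definition embeds (T U : countType) (X : set T)
    (I : ideal X) (L : ideal [set: U]) : Prop :=
  exists2 f : T -> U, set_inj X f &
    forall A : set T, A `<=` X -> (I A <-> L (f @` A)).

Lemma finite_set_image_inj (T U : Type) (A : set T) (f : T -> U) :
  set_inj A f -> finite_set (f @` A) -> finite_set A.
Proof.
by move=> finj; rewrite (eq_finite_set (inj_card_eq finj)).
Qed.

Lemma embeds_restr (T U : countType) (X : set T) (I : ideal X)
    (L : ideal [set: U]) :
  embeds I L -> exists A : set U, ideal_iso I (restr L (@subsetT _ A)).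
Proof.
case=> f finj fP; exists (f @` X), f; split; first exact: inj_bij.
move=> A AX; rewrite fP //; split=> [LA|[]//].
by split=> //; apply: image_subset.
Qed.

Lemma embeds_iso (T U V : countType) (x0 : T) (X : set T) (Y : set U)
    (I : ideal X) (J : ideal Y) (L : ideal [set: V]) :
  ideal_iso I J -> embeds I L -> embeds J L.
Proof.
case=> f [[fun_f inj_f surj_f] fP] [g inj_g gP].
(* [k] inverts [f] on [Y]; [x0] is a default value outside [Y]. *)
have /choice[k kP] y : exists x, Y y -> X x /\ f x = y.
  have [Yy|nYy] := pselect (Y y); last by exists x0.
  by have [x Xx <-] := surj_f _ Yy; exists x.
exists (g \o k) => [y z /set_mem Yy /set_mem Yz /= /inj_g kyz|B BY].
  have [Xky <-] := kP _ Yy; have [Xkz <-] := kP _ Yz.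
  by rewrite kyz //; apply: mem_set.
have kBX : k @` B `<=` X by move=> _ [y /BY /kP[Xky _] <-].
rewrite -image_comp -gP // fP //.
suff -> : f @` (k @` B) = B by [].
apply/seteqP; split=> [_ [_ [y By <-] <-]|y By].
  by have [_ ->] := kP _ (BY _ By).
by exists (k y); [exists y|have [_ ->] := kP _ (BY _ By)].
Qed.

(** The same [f] works: a member of [L] meets the image of [B] only in the image of its preimage in
    [X], which lies in [I]; conversely, injectivity reflects finiteness. *)
Lemma embeds_orth (T U : countType) (X : set T) (I : ideal X)
    (L : ideal [set: U]) :
  embeds I L -> embeds (orth I) (orth L).
Proof.
case=> f finj fP; exists f => // B BX; split=> [[_ BI]|[_ BL]].
  split=> // C LC.
  have XC : X `&` f @^-1` C `<=` X by apply: subIsetl.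
  have IC : I (X `&` f @^-1` C).
    by apply/fP => //; apply: ideal_sub LC => _ [x [_ Cx] <-].
  apply: sub_finite_set (finite_image f (BI _ IC)).
  by move=> y [Cy [x Bx fx]]; exists x => //; split=> //; split;
    [apply: BX|rewrite /= fx].
split=> // A IA; have AX := ideal_subset IA.
have ABX : A `&` B `<=` X by move=> x [/AX].
apply: (@finite_set_image_inj _ _ _ f).
  by move=> x y /set_mem ABx /set_mem ABy; apply: finj; apply/mem_set/ABX.
apply: sub_finite_set (BL _ ((fP _ AX).1 IA)).
by move=> _ [x [Ax Bx] <-]; split; exists x.
Qed.

(** The cones above the nodes [p n] are disjoint, so each can host one summand; the other two
    hypotheses let membership in [L] be tested cone by cone, matching the definition of [dsum]. *)
Lemma embeds_dsum (L : ideal [set: seq nat]) (p : nat -> seq nat) :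
    (forall m n s t, p m ++ s = p n ++ t -> m = n) ->
    (forall A n, L A -> L (cat (p n) @^-1` A)) ->
    (forall A, A `<=` \bigcup_n range (cat (p n)) ->
       (forall n, L (cat (p n) @^-1` A)) -> L A) ->
  forall (D : set nat) (K : nat -> set nat) (J : forall n, ideal (K n)),
    partition D K [set: nat] -> (forall n, D n -> embeds (J n) L) ->
  embeds (dsum D J) L.
Proof.
move=> p_incomp L_preim L_join D K J [covD tD _] JL.
have /choice[h hP] n : exists f : nat -> seq nat, D n ->
    set_inj (K n) f /\
    forall A : set nat, A `<=` K n -> (J n A <-> L (f @` A)).
  have [/JL[f]|nDn] := pselect (D n); first by exists f.
  by exists (fun=> [::]).
have /choice[idx idxP] k : exists n, D n /\ K n k.
  have : [set: nat] k by [].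
  by rewrite -covD => -[n Dn Kk]; exists n.
have idx_eq k n : D n -> K n k -> idx k = n.
  by have [Di Ki] := idxP k => Dn Kn; apply: (tD) => //; exists k.
(* Each [k] is sent into the cone of its own piece, by the embedding [h] of that piece. *)
pose f k := p (idx k) ++ h (idx k) k.
have f_preim (B : set nat) n :
    D n -> cat (p n) @^-1` (f @` B) = h n @` (B `&` K n).
  move=> Dn; apply/seteqP; split=> [s [k Bk]|_ [k [Bk Kk] <-]].
    rewrite /f => e; have idk := p_incomp _ _ _ _ e.
    have [_] := idxP k; rewrite idk => Kk.
    by exists k => //; move/eqP: e; rewrite idk eqseq_cat // eqxx => /eqP.
  by exists k; rewrite // /f (idx_eq _ _ Dn Kk).
exists f => [k l _ _|B _].
  rewrite /f => e; have ikl := p_incomp _ _ _ _ e.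
  move/eqP: e; rewrite ikl eqseq_cat // eqxx => /eqP.
  have [Dl Kl] := idxP l; have [_] := idxP k; rewrite ikl => Kk.
  by apply: (hP _ Dl).1; apply: mem_set.
have JP n : D n -> (J n (B `&` K n) <-> L (cat (p n) @^-1` (f @` B))).
  by move=> Dn; rewrite f_preim //; apply: (hP _ Dn).2; apply: subIsetr.
split=> [BJ|LB n Dn]; last by apply/JP => //; apply: L_preim.
apply: L_join => [_ [k _ <-]|n]; first by exists (idx k) => //; eexists.
have [Dn|nDn] := pselect (D n); first exact/JP/BJ.
(* For [n] outside [D] the cone above [p n] receives no point. *)
apply: ideal_finite => //; suff -> : cat (p n) @^-1` (f @` B) = set0 by [].
apply/seteqP; split=> // s [k _ /p_incomp ikn]; apply: nDn.
by rewrite -ikn; have [] := idxP k.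
Qed.

Lemma mkseqD (T : Type) (a : nat -> T) m n :
  mkseq a (m + n) = mkseq a m ++ mkseq (fun i => a (m + i)) n.
Proof.
rewrite /mkseq iotaD map_cat add0n.
by rewrite -[in iota m n](addn0 m) iotaDl -map_comp.
Qed.

Definition prepend (p : seq nat) (a : nat -> nat) i :=
  if i < size p then nth 0 p i else a (i - size p).

Lemma mkseq_prepend p a n : mkseq (prepend p a) (size p + n) = p ++ mkseq a n.
Proof.
rewrite mkseqD; congr (_ ++ _).
  apply: (@eq_from_nth _ 0); rewrite size_mkseq // => i ip.
  by rewrite nth_mkseq // /prepend ip.
by apply: eq_mkseq => i; rewrite /prepend ltnNge leq_addr addKn.
Qed.

(** The downward closure of [A] is the least tree containing [A], so only its branches matter. *)
Lemma IwfP (A : set (seq nat)) :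
  Iwf A <-> ~ exists a, forall n, exists2 s, A s & prefix (mkseq a n) s.
Proof.
split=> [[T [treeT wfT] AT] [a aA]|nA].
  apply: wfT; exists a => n; have [s As ns] := aA n.
  exact: treeT ns (AT _ As).
exists [set t | exists2 s, A s & prefix t s]; last first.
  by move=> s As; exists s => //; apply: prefix_refl.
split=> [s t st [u Au tu]|//].
by exists u => //; apply: prefix_trans tu.
Qed.

(** Otherwise members of [A] follow [a] arbitrarily far, making [a] a branch of the downward
    closure. The bound [N] is what later yields finiteness. *)
Lemma Iwf_leave_branch (A : set (seq nat)) (a : nat -> nat) :
  Iwf A -> exists N, forall s n, A s -> prefix (mkseq a n) s -> n < N.
Proof.
move=> /IwfP nA; apply: contrapT => nN; apply: nA; exists a => N.
apply: contrapT => nS; apply: nN; exists N => s n As ns.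
rewrite ltnNge; apply/negP => Nn; apply: nS; exists s => //.
by apply: prefix_trans ns; apply: prefix_mkseq.
Qed.

Lemma Iwf_preimage_cat p (A : set (seq nat)) : Iwf A -> Iwf (cat p @^-1` A).
Proof.
move=> /IwfP nA; apply/IwfP => -[a aA]; apply: nA; exists (prepend p a) => n.
have [s As ns] := aA n; exists (p ++ s) => //.
(* [n] may be smaller than [size p]; the segment of length [size p + n] splits as [p] followed by a
   segment of [a]. *)
apply: (@prefix_trans _ (mkseq (prepend p a) (size p + n))).
  by apply: prefix_mkseq; apply: leq_addl.
by rewrite mkseq_prepend prefix_catr // eqxx.
Qed.

Lemma Iwf_image_cat p (A : set (seq nat)) : Iwf A -> Iwf (cat p @` A).
Proof.
move=> /IwfP nA; apply/IwfP => -[a aA]; apply: nA.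
exists (fun i => a (size p + i)) => n; have [_ [s As <-]] := aA (size p + n).
rewrite mkseqD prefix_catr ?size_mkseq // => /andP[_ ns].
by exists s.
Qed.

(** A branch [a] stays above the single node [[:: a 0]]; dropping its first entry gives a branch for
    that one piece. *)
Lemma Iwf_join (A : set (seq nat)) :
  A `<=` \bigcup_n range (cat [:: n]) ->
  (forall n, Iwf (cat [:: n] @^-1` A)) -> Iwf A.
Proof.
move=> _ wfA; apply/IwfP => -[a aA]; have /IwfP := wfA (a 0); apply.
exists (fun i => a i.+1) => n; have [s As] := aA (1 + n).
by rewrite mkseqD => /prefixP[t st]; exists (mkseq (fun i => a i.+1) n ++ t);
  [rewrite /= st in As|apply: prefix_prefix].
Qed.

Lemma Id_preimage_cat p (B : set (seq nat)) : Id B -> Id (cat p @^-1` B).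
Proof.
move=> [_ Bd]; split=> // C wfC; have := Bd _ (Iwf_image_cat p wfC).
have catI : injective (cat p).
  by move=> s t /(congr1 (drop (size p))); rewrite !drop_size_cat.
move=> fin; apply: (@finite_set_image_inj _ _ _ (cat p)); first exact: in2W.
by apply: sub_finite_set fin => _ [s [Cs Bs] <-]; split=> //; exists s.
Qed.

Lemma mkseq_cst (T : Type) (x : T) n : mkseq (fun=> x) n = nseq n x.
Proof. by elim: n => [|n IH] //; rewrite -add1n mkseqD IH. Qed.

(** The nodes [[:: n]] would fail for [Id]: together they form an infinite member of [Iwf], although
    each cone contains only one of them. *)
Definition comb_node n : seq nat := rcons (nseq n 0) 1.

Lemma comb_node_incomp m n s t :
  comb_node m ++ s = comb_node n ++ t -> m = n.
Proof.
by elim: m n => [|m IH] [|n] //= [] e; congr _.+1; apply: IH.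
Qed.

Lemma Id_join (B : set (seq nat)) :
  B `<=` \bigcup_n range (cat (comb_node n)) ->
  (forall n, Id (cat (comb_node n) @^-1` B)) -> Id B.
Proof.
move=> Bcup Bd; split=> // C wfC.
(* A member of [C] above [comb_node n] extends the segment of [n] zeros, so [n < N]. *)
have [N NP] := Iwf_leave_branch (fun=> 0) wfC.
apply: (@sub_finite_set _ _ (\bigcup_(n in `I_N)
    (cat (comb_node n) @`
      (cat (comb_node n) @^-1` C `&` cat (comb_node n) @^-1` B)))).
  move=> s [Cs Bs]; have [n _ [t _ ts]] := Bcup _ Bs.
  exists n; last by exists t => //; split; rewrite /= ts.
  apply: NP Cs _; rewrite mkseq_cst -ts /comb_node cat_rcons.
  exact: prefix_prefix.
apply: bigcup_finite => // n _; apply: finite_image.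
by apply: (Bd n).2; apply: Iwf_preimage_cat.
Qed.

Lemma orth_Id (A : set (seq nat)) : orth Id A <-> Iwf A.
Proof.
split=> [[_ Ad]|wfA]; last by split=> // B [_ /(_ _ wfA)]; rewrite setIC.
apply/IwfP => -[a aA].
have /choice[s sP] n : exists s, A s /\ prefix (mkseq a n) s.
  by have [s] := aA n; exists s.
have sd : Id (range s).
  (* A well-founded [C] contains [s n] only for [n < N]. *)
  split=> // C wfC; have [N NP] := Iwf_leave_branch a wfC.
  apply: sub_finite_set (finite_image s (finite_II N)).
  move=> t [Ct [n _ nt]]; exists n => //; apply: (NP _ _ Ct).
  by rewrite -nt; case: (sP n).
have := Ad _ sd; rewrite setIidl; last by move=> _ [n _ <-]; case: (sP n).
move=> /finite_seqP[r rP].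
(* [N] exceeds every length in the finite range of [s], yet [s N] extends a segment of length
   [N]. *)
pose N := (\max_(t <- r) size t).+1.
have : [set` r] (s N) by rewrite -rP; exists N.
move=> /= rsN; have [_ /size_prefix] := sP N.
by rewrite size_mkseq ltnNge leq_bigmax_seq.
Qed.

(** Segments of the zero branch form a member of [Iwf] only if their lengths are bounded. *)
Lemma fin_embeds_Iwf : embeds (fin_ideal [set: nat]) Iwf.
Proof.
exists (nseq^~ 0) => [m n _ _ /(congr1 size)|A _]; first by rewrite !size_nseq.
split=> [[_ fin]|wfA]; first by apply: ideal_finite => //; apply: finite_image.
split=> //; have [N NP] := Iwf_leave_branch (fun=> 0) wfA.
apply: sub_finite_set (finite_II N) => n An; apply: (NP (nseq n 0)).
  by exists n.
by rewrite mkseq_cst prefix_refl.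
Qed.

(** All sequences of length one together lie in [Iwf], so a set of them in [Id] is finite. *)
Lemma fin_embeds_Id : embeds (fin_ideal [set: nat]) Id.
Proof.
have inj1 : injective (fun n : nat => [:: n]) by move=> m n [].
exists (fun n => [:: n]) => [|A _]; first exact: in2W.
split=> [[_ fin]|[_ dA]]; first by apply: ideal_finite => //; apply: finite_image.
split=> //; apply: (@finite_set_image_inj _ _ _ (fun n => [:: n])).
  exact: in2W.
rewrite -[X in finite_set X]setIid; apply: dA.
by exists [set s | size s <= 1]; [exact: well_founded_tree_size|move=> _ [n _ <-]].
Qed.

Lemma calB_embeds (I : ideal [set: nat]) : calB I -> embeds I Iwf /\ embeds I Id.
Proof.
elim=> {I} [|I _ [wfI dI]|D K I J part _ IH IJ|I J _ [wfI dI] IJ].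
- by split; [exact: fin_embeds_Iwf|exact: fin_embeds_Id].
(* [Id] is [orth Iwf] by definition, and [orth Id] has the same members as [Iwf]. *)
- split; last exact: embeds_orth.
  have [f finj fP] := embeds_orth dI.
  by exists f => // A AX; rewrite fP // orth_Id.
- split.
    apply: (@embeds_dsum _ (fun n => [:: n])) part _ => [m n s t []//|A n|A|n Dn].
    + exact: Iwf_preimage_cat.
    + exact: Iwf_join.
    + exact: (embeds_iso 0 (IJ n Dn) (IH n Dn).1).
  apply: (@embeds_dsum _ comb_node) part _ => [|A n|A|n Dn].
  + exact: comb_node_incomp.
  + exact: Id_preimage_cat.
  + exact: Id_join.
  + exact: (embeds_iso 0 (IJ n Dn) (IH n Dn).2).
- by split; [exact: (embeds_iso 0 IJ wfI)|exact: (embeds_iso 0 IJ dI)].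
Qed.

Theorem theorem4p1 (I : ideal [set: nat]) (hI : calB I) :
  exists A A' : set (seq nat),
    ideal_iso I (restr Iwf (@subsetT _ A)) /\
    ideal_iso I (restr Id (@subsetT _ A')).
Proof.
have [/embeds_restr[A IA] /embeds_restr[A' IA']] := calB_embeds hI.
by exists A, A'.
Qed.
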